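(* Let $m>0$, and let $S_j=mj$ and $d_j=1$ for all integers $j\ge0$. Let $F:\mathbb{R}\to\mathbb{R}$ be the function built from $(S_j)$ and $(d_j)$ as described in the context. Consider the Bregman distance (proximal) method with $\theta_0=0$ in which, for each $k\ge1$, $\theta_k$ is taken to be a local minimizer over $\theta\in\mathbb{R}$ of $$\theta\mapsto F(\theta)+\frac{1}{2m}(\theta-\theta_{k-1})^2 .$$ Then there is a choice of local minimizers such that $\lim_k F(\theta_k)=\infty$ and $\inf_k|\dot F(\theta_k)|=1$.
   Context: $\dot F$ denotes the derivative of $F$. For $m>0$ and $d,\delta\in(0,1]$ let $f(\cdot\,;m,d,\delta):[0,m]\to\mathbb{R}$ be given by $$f(\theta;m,d,\delta)=\begin{cases} -d\theta & \theta\in(0,\frac{2-d}{16}m)\\ \frac{8}{m}(\theta-\frac m8)^2-m\frac{-d^2+4d}{32} & \theta\in[\frac{2-d}{16}m,\frac{3}{16}m)\\ -\frac{5m}{16}\exp\left(\frac{5/16}{\theta/m-1/2}+1\right)+m\frac{11+d^2-4d}{32} & \theta\in(\frac{3}{16}m,\frac12 m)\\ m\frac{11+d^2-4d}{32} & \theta=\frac12 m\\ \frac{5m}{16}\exp\left(\frac{-5/16}{\theta/m-1/2}+1\right)+m\frac{11+d^2-4d}{32} & \theta\in(\frac12 m,\frac{13}{16}m)\\ -\frac{8}{m}(\theta-\frac{7m}{8})^2+m\frac{22+d^2-4d}{32} & \theta\in[\frac{13}{16}m,\frac{\delta+14}{16}m)\\ -\delta\theta+m\frac{22+d^2+\delta^2-4d+28\delta}{32}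 & \theta\in[\frac{\delta+14}{16}m,m] \end{cases}$$ and extended to $\theta=0$ and $\theta=\frac{3}{16}m$ by continuity. Given a strictly increasing real sequence $(S_j)_{j\ge0}$ and a sequence $(d_j)_{j\ge 0}$ in $(0,1]$, the function $F$ is defined (recursively in $j$) on $(-\infty,\sup_j S_j)$ by $F(\theta)=-d_0(\theta-S_0)$ for $\theta\le S_0$; $F(\theta)=f(\theta-S_0;S_1-S_0,d_0,d_1)$ for $\theta\in(S_0,S_1]$; and $F(\theta)=f(\theta-S_j;S_{j+1}-S_j,d_j,d_{j+1})+F(S_j)$ for $\theta\in(S_j,S_{j+1}]$, $j=1,2,\dots$. It is defined on all of $\mathbb{R}$ when $\sup_j S_j=\infty$. *)

(* Defs.v *)
From HB Require Import structures.
From mathcomp Require Import all_boot all_order all_algebra.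
From mathcomp Require Import ring lra.
From mathcomp Require Import all_classical all_reals all_analysis.

Set Implicit Arguments.
Unset Strict Implicit.
Unset Printing Implicit Defensive.

Import Order.TTheory GRing.Theory Num.Theory.
Import numFieldNormedType.Exports.

Local Open Scope classical_set_scope.
Local Open Scope ring_scope.

Section Definitions.
Context {R : realType}.
Implicit Types (m d delta t : R) (S D : nat -> R).

(* Meaningful for m > 0, d and delta in ]0, 1] and t in [0, m]. The endpoints
   t = 0 and t = 3m/16, where the value is prescribed by continuous extension,
   are absorbed in the first two branches; see piece_cvg0 and piece_cvg316. *)
Definition piece m d delta t : R :=
  if t < (2 - d) / 16 * m then - d * t
  else if t <= 3 / 16 * m then
    8 / m * (t - m / 8) ^+ 2 - m * ((- d ^+ 2 + 4 * d) / 32)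
  else if t < m / 2 then
    - (5 * m / 16) * expR ((5 / 16) / (t / m - 1 / 2) + 1)
    + m * ((11 + d ^+ 2 - 4 * d) / 32)
  else if t == m / 2 then m * ((11 + d ^+ 2 - 4 * d) / 32)
  else if t < 13 / 16 * m then
    (5 * m / 16) * expR ((- (5 / 16)) / (t / m - 1 / 2) + 1)
    + m * ((11 + d ^+ 2 - 4 * d) / 32)
  else if t < (delta + 14) / 16 * m then
    - (8 / m) * (t - 7 * m / 8) ^+ 2 + m * ((22 + d ^+ 2 - 4 * d) / 32)
  else
    - delta * t
    + m * ((22 + d ^+ 2 + delta ^+ 2 - 4 * d + 28 * delta) / 32).

(* knot S D j is the value at S j of the glued function, see glued_knot. *)
Fixpoint knot S D (j : nat) : R :=
  if j is i.+1 then
    piece (S i.+1 - S i) (D i) (D i.+1) (S i.+1 - S i) + knot S D i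
  else 0.

(* For S strictly increasing and t in ]S 0, sup_j S j[, the index j with
   t \in ]S j, S j.+1] exists and is unique; for t >= sup_j S j the value is
   irrelevant. The recursive equations are glued_first and glued_step. *)
Definition glued S D t : R :=
  if t <= S 0 then - D 0 * (t - S 0)
  else let j := xget 0%N [set j | S j < t <= S j.+1] in
       piece (S j.+1 - S j) (D j) (D j.+1) (t - S j) + knot S D j.

Definition local_minimizer (g : R -> R) t := \forall u \near t, g t <= g u.

Lemma piece_cvg0 m d delta : 0 < m -> 0 < d <= 1 ->
  piece m d delta t @[t --> 0^'+] --> piece m d delta 0.
Proof.
move=> m0 /andP[d0 d1].
have c0 : 0 < (2 - d) / 16 * m by rewrite mulr_gt0// divr_gt0//; lra.
have -> : piece m d delta 0 = - d * 0 by rewrite /piece c0.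
apply: (@cvg_trans _ ((fun t => - d * t) @ 0^'+)).
  apply: near_eq_cvg; near=> t.
  have tc : t < (2 - d) / 16 * m by near: t; exact: nbhs_right_lt.
  by rewrite /piece tc.
by apply: cvg_at_right_filter; apply: cvgM; [exact: cvg_cst|exact: cvg_id].
Unshelve. all: by end_near. Qed.

Lemma piece_cvg316 m d delta : 0 < m -> 0 < d <= 1 ->
  {for 3 / 16 * m, continuous (piece m d delta)}.
Proof.
move=> m0 /andP[d0 d1]; set a := 3 / 16 * m.
have mN0 : m != 0 by rewrite gt_eqF.
have ca : (2 - d) / 16 * m < a by rewrite ltr_pM2r//; lra.
have am : a < m / 2 by rewrite /a; lra.
pose q t := 8 / m * (t - m / 8) ^+ 2 - m * ((- d ^+ 2 + 4 * d) / 32).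
pose e t := - (5 * m / 16) * expR ((5 / 16) / (t / m - 1 / 2) + 1)
    + m * ((11 + d ^+ 2 - 4 * d) / 32).
have pa : piece m d delta a = q a by rewrite /piece ltNge (ltW ca)/= lexx.
have qa : q a = e a.
  rewrite /q /e /a.
  have -> : 3 / 16 * m / m - 1 / 2 = - (5 / 16) :> R by field.
  by rewrite invrN mulrN divff ?addNr ?expR0; [field|lra].
apply/left_right_continuousP; rewrite pa; split.
  apply: (@cvg_trans _ (q @ a^'-)).
    apply: near_eq_cvg; near=> t; rewrite /piece.
    have -> : (t < (2 - d) / 16 * m) = false.
      by apply/negbTE; rewrite -leNgt; near: t; exact: nbhs_left_ge.
    by have -> : t <= 3 / 16 * m by near: t; exact: nbhs_left_le.
  apply: cvg_at_left_filter; apply: cvgB; last exact: cvg_cst.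
  apply: cvgM; first exact: cvg_cst.
  by apply: cvgM; (apply: cvgB; [exact: cvg_id|exact: cvg_cst]).
rewrite qa; apply: (@cvg_trans _ (e @ a^'+)).
  apply: near_eq_cvg; near=> t; rewrite /piece.
  have at_ : a < t by near: t; exact: nbhs_right_gt.
  have -> : (t < (2 - d) / 16 * m) = false.
    by apply/negbTE; rewrite -leNgt ltW// (lt_trans ca).
  rewrite leNgt at_ /=.
  by have -> : t < m / 2 by near: t; exact: nbhs_right_lt.
apply: cvg_at_right_filter; apply: cvgD; last exact: cvg_cst.
apply: cvgM; first exact: cvg_cst.
apply: continuous_cvg; first exact: continuous_expR.
apply: cvgD; last exact: cvg_cst.
apply: cvgM; first exact: cvg_cst.
apply: cvgV.
  by rewrite /a mulfK// lt_eqF//; lra.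
apply: cvgB; last exact: cvg_cst.
by apply: cvgM; [exact: cvg_id|exact: cvg_cst].
Unshelve. all: by end_near. Qed.

Lemma glued_left S D t : t <= S 0 -> glued S D t = - D 0 * (t - S 0).
Proof. by rewrite /glued => ->. Qed.

Lemma gluedE S D j t : {homo S : i k / (i < k)%N >-> i < k} ->
  S j < t <= S j.+1 ->
  glued S D t =
    piece (S j.+1 - S j) (D j) (D j.+1) (t - S j) + knot S D j.
Proof.
move=> Si jt; have {}Sle i k : (i <= k)%N -> S i <= S k.
  by rewrite leq_eqVlt => /predU1P[->//|/Si/ltW].
have /andP[jt1 jt2] := jt.
rewrite /glued leNgt (le_lt_trans (Sle 0 j isT) jt1)/=.
suff -> : xget 0%N [set j | S j < t <= S j.+1] = j by [].
apply: xget_unique => // k /andP[kt1 kt2]; apply/eqP; rewrite eqn_leq.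
apply/andP; split; rewrite leqNgt; apply/negP => /Sle jk.
  by have := lt_le_trans kt1 (le_trans jt2 jk); rewrite ltxx.
by have := lt_le_trans jt1 (le_trans kt2 jk); rewrite ltxx.
Qed.

Lemma glued_knot S D j : {homo S : i k / (i < k)%N >-> i < k} ->
  glued S D (S j) = knot S D j.
Proof.
move=> Si; case: j => [|j]; first by rewrite glued_left// subrr mulr0.
by rewrite (gluedE _ (j := j))// Si//=.
Qed.

Lemma glued_first S D t : {homo S : i k / (i < k)%N >-> i < k} ->
  S 0 < t <= S 1 -> glued S D t = piece (S 1 - S 0) (D 0) (D 1) (t - S 0).
Proof. by move=> Si /(gluedE D Si) ->; rewrite addr0. Qed.

Lemma glued_step S D j t : {homo S : i k / (i < k)%N >-> i < k} ->
  S j < t <= S j.+1 ->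
  glued S D t =
    piece (S j.+1 - S j) (D j) (D j.+1) (t - S j) + glued S D (S j).
Proof. by move=> Si /(gluedE D Si) ->; rewrite glued_knot. Qed.

End Definitions.

(* Main.v *)
Require Import Defs.
From HB Require Import structures.
From mathcomp Require Import all_boot all_order all_algebra.
From mathcomp Require Import ring lra.
From mathcomp Require Import all_classical all_reals all_analysis.

Import Order.TTheory GRing.Theory Num.Theory.
Import numFieldNormedType.Exports.

Local Open Scope classical_set_scope.
Local Open Scope ring_scope.

(** The witness is the sequence of knots, [theta k = m * k].  With all slopes
    equal to [1], the last branch of one bump and the first branch of the next
    are affine with the same slope [-1], so [F] is affine with slope [-1] around
    each knot, whereas each whole bump raises [F] by [m / 2]
    ([glued_unit_near_knot]).  Thus [F] sends the knots to [k * m / 2], which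
    tends to infinity, although its derivative at every knot is [-1].

    The knots are consecutive local minimizers because the step [m] balances the
    slope against the proximal term of parameter [m]: at distance [u] from the
    knot [m * k.+1] the objective centered at [m * k] is a constant plus
    [- u + (m + u)^2 / (2 m) = m / 2 + u^2 / (2 m)], which is least at
    [u = 0]. *)

Lemma piece_last_branch {R : realType} (m d delta t : R) :
  0 < m -> 0 < d <= 1 -> 0 < delta -> (delta + 14) / 16 * m <= t ->
  piece m d delta t = - delta * t
    + m * ((22 + d ^+ 2 + delta ^+ 2 - 4 * d + 28 * delta) / 32).
Proof.
move=> m0 /andP[d0 d1] delta0 ht.
have deltam : 0 < delta * m by exact: mulr_gt0.
have dm : 0 < d * m by exact: mulr_gt0.
rewrite /piece ifF; last by apply/negbTE; rewrite -leNgt; lra.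
rewrite ifF; last by apply/negbTE; rewrite -ltNge; lra.
rewrite ifF; last by apply/negbTE; rewrite -leNgt; lra.
rewrite ifF; last by apply/negbTE; rewrite gt_eqF//; lra.
rewrite ifF; last by apply/negbTE; rewrite -leNgt; lra.
by rewrite ifF//; apply/negbTE; rewrite -leNgt.
Qed.

Section UnitSlopes.
Context {R : realType} (m : R) (m_gt0 : 0 < m).

Let S (j : nat) : R := m * j%:R.
Let F : R -> R := glued S (fun _ : nat => 1).

Let S_step j : S j.+1 - S j = m.
Proof. by rewrite /S -natr1; ring. Qed.

Let S_lt : {homo S : i k / (i < k)%N >-> i < k}.
Proof. by move=> i k ik; rewrite /S ltr_pM2l// ltr_nat. Qed.

Lemma knot_unit j : knot S (fun _ : nat => 1) j = m / 2 * j%:R.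
Proof.
elim: j => [|j IHj]; first by rewrite mulr0.
rewrite /= IHj S_step piece_last_branch//; last 2 first.
- by rewrite ltr01 lexx.
- by have := m_gt0; lra.
by rewrite -natr1; field.
Qed.

(** The radius [m / 16] is the length of the affine branches at the two ends of
    a bump whose end slopes are [1]. *)
Lemma glued_unit_near_knot j t : S j - m / 16 < t < S j + m / 16 ->
  F t = m / 2 * j%:R - (t - S j).
Proof.
have m0 := m_gt0.
move=> /andP[lt_t t_lt]; have [tS|St] := leP t (S j); last first.
  rewrite /F (@gluedE _ _ _ j) ?S_step//; last first.
    by rewrite St /=; have := S_step j; lra.
  by rewrite knot_unit /piece ifT; [ring|lra].
case: j lt_t t_lt tS => [|j] lt_t t_lt tS.
  by rewrite /F glued_left// mulr0; ring.
have Sj := S_step j.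
rewrite /F (@gluedE _ _ _ j)// ?tS ?andbT ?S_step//; last by lra.
rewrite knot_unit piece_last_branch//; last 2 first.
- by rewrite ltr01 lexx.
- by lra.
by move: Sj; rewrite -natr1; lra.
Qed.

Lemma glued_unit_eq_near_knot j :
  \forall t \near S j, F t = m / 2 * j%:R - (t - S j).
Proof.
have m0 := m_gt0.
near=> t; apply: glued_unit_near_knot; apply/andP; split.
  by near: t; apply: lt_nbhsr; lra.
by near: t; apply: lt_nbhsl; lra.
Unshelve. all: by end_near. Qed.

Lemma glued_unit_at_knot j : F (S j) = m / 2 * j%:R.
Proof. by rewrite (nbhs_singleton (glued_unit_eq_near_knot j)) subrr subr0. Qed.

Lemma is_derive_glued_unit j : is_derive (S j) (1 : R) F (- 1).
Proof.
apply: (@near_eq_is_derive _ _ _ (fun t => m / 2 * j%:R - (t - S j))).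
  by apply: filterS (glued_unit_eq_near_knot j) => t ->.
by apply: is_derive_eq; rewrite subr0 add0r mul1r.
Qed.

Lemma knot_local_minimizer j :
  local_minimizer (fun t : R => F t + 1 / (2 * m) * (t - S j) ^+ 2) (S j.+1).
Proof.
rewrite /local_minimizer glued_unit_at_knot.
apply: filterS (glued_unit_eq_near_knot j.+1) => t ->.
have mN0 : m != 0 by rewrite gt_eqF.
rewrite -subr_ge0 S_step.
(* Completing the square: the linear terms cancel since the step is m. *)
have -> : m / 2 * j.+1%:R - (t - S j.+1) + 1 / (2 * m) * (t - S j) ^+ 2
    - (m / 2 * j.+1%:R + 1 / (2 * m) * m ^+ 2)
  = 1 / (2 * m) * (t - S j.+1) ^+ 2.
  by rewrite /S -natr1; field.
by rewrite mulr_ge0 ?sqr_ge0// divr_ge0// mulr_ge0// ltW.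
Qed.

End UnitSlopes.

Theorem proposition3p7 (R : realType) (m : R) (hm : 0 < m) :
  let F : R -> R := glued (fun j : nat => m * j%:R) (fun _ : nat => 1) in
  exists theta : nat -> R,
    [/\ theta 0%N = 0,
        forall k : nat, local_minimizer
          (fun t : R => F t + 1 / (2 * m) * (t - theta k) ^+ 2) (theta k.+1),
        F (theta k) @[k --> \oo] --> +oo,
        forall k : nat, derivable F (theta k) 1
      & inf (range (fun k : nat => `|F^`()%classic (theta k)|)) = 1].
Proof.
move=> F; exists (fun k => m * k%:R); split.
- by rewrite mulr0.
- exact: knot_local_minimizer.
- under eq_fun do rewrite /F glued_unit_at_knot//.
  have m2 : 0 < m / 2 by rewrite divr_gt0.
  exact: (gt0_cvgMry (F := n%:R @[n --> \oo]) (f := id) m2 cvgr_idn).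
- by move=> k; have [] := is_derive_glued_unit _ hm k.
- have abs_dF k : `|F^`()%classic (m * k%:R)| = 1.
    by have [_ dF] := is_derive_glued_unit _ hm k;
       rewrite derive1E dF normrN1.
  under eq_fun do rewrite abs_dF.
  suff -> : range (fun _ : nat => 1 : R) = [set 1] by exact: inf1.
  by apply/seteqP; split => [_ [_ _ <-]//|_ ->]; exists 0%N.
Qed.
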